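(* Let $(\mathbb N,E)$ be a self-similar graph satisfying the assumption that for every $e\in E^1$ there is $m\in\mathbb N$ with $m|_e\neq0$. If $(\mathcal V,\mathcal S)$ is a representation of $(\mathbb N,E)$ on a nonzero Hilbert space which is of pure + CK type or left regular, then $(\mathcal V,\mathcal S)$ has a non-trivial dilation.
   Context: Graphs. $E=(E^0,E^1,r,s)$ is a finite directed graph (vertices $E^0$, edges $E^1$, range and source maps $r,s$), source-free: $vE^1:=\{e\in E^1: r(e)=v\}\neq\emptyset$ for every $v\in E^0$. $E^*$ is the set of finite paths (vertices are paths of length $0$; $\mu\nu$ is a path when $s(\mu)=r(\nu)$). $\mathbb N=\{0,1,2,\dots\}$. $\operatorname{Aut}(E)$ is the group of bijections of $E^0\cup E^1$ preserving $E^0$ and $E^1$ and commuting with $r$ and $s$. Self-similar graph $(\mathbb N,E)$: a semigroup homomorphism $\mathbb N\to\operatorname{Aut}(E)$, written $p\cdot\mu$, together with a restriction map $\mathbb N\times(E^0\cup E^1)\to\mathbb N$, $(p,\mu)\mapsto p|_\mu$, such that $(p+q)|_\mu=p|_{q\cdot\mu}+q|_\mu$; $p|_v=p$ for $v\in E^0$; $0|_e=0$ for $e\in E^1$; and $p|_e\cdot v=p\cdot v$ whenever $s(e)=v$. Action and restriction extend to $E^*$ by $p\cdot(\mu\nu)=(p\cdot\mu)(p|_\mu\cdot\nu)$ and $p|_{\mu\nu}=(p|_\mu)|_\nu$. TCK families. A Toeplitz-Cuntz-Krieger (TCK) $E$-family $\mathcal S=\{S_\mu:\mu\in E^0\cup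 E^1\}$ consists of pairwise orthogonal projections $S_v$ ($v\in E^0$) and operators $S_e$ ($e\in E^1$) with $S_e^*S_e=S_{s(e)}$ and $\sum_{e\in vE^1}S_eS_e^*\le S_v$ for all $v$. It is Cuntz-Krieger (CK) if equality holds for all $v$. For $\mu=e_1\cdots e_k$, $S_\mu=S_{e_1}\cdots S_{e_k}$. Families are taken nondegenerate: $\sum_{v\in E^0}S_v=I$. (Toeplitz) representation of $(\mathbb N,E)$: a pair $(\mathcal V,\mathcal S)$ with $\mathcal V=\{V_p\}_{p\in\mathbb N}$ isometries, $V_pV_q=V_{p+q}$, $V_0=I$, and $\mathcal S$ a TCK $E$-family, such that $V_pS_\mu=S_{p\cdot\mu}V_{p|_\mu}$ and $V_p^*S_{p\cdot\mu}=S_\mu V_{p|_\mu}^*$ for all $p\in\mathbb N$, $\mu\in E^0\cup E^1$. It is of pure + CK type if $V_1$ is a pure isometry (a multiple of the unilateral shift) and $\mathcal S$ is CK. Left regular: on $\ell^2(E^*\times\mathbb N)$ with basis $\delta_{\mu,p}$, let $V_q\delta_{\mu,p}=\delta_{q\cdot\mu,\,q|_\mu+p}$ and $S_\nu\delta_{\mu,p}=\delta_{\nu\mu,p}$ if $s(\nu)=r(\mu)$, $0$ otherwise; for $v\in E^0$ let $(\lambda_v^{\mathbb N},\lambda_v^E)$ be the restriction to the reducing subspace $\overline{\operatorname{span}}\{\delta_{\mu,p}:s(\mu)=p\cdot v\}$. A representation is left regular if it is (unitarily equivalent to) a direct sum of amplifications of the $(\lambda_v^{\mathbb N},\lambda_v^E)$,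 $v\in E^0$. Dilation: a representation $(\mathcal V',\mathcal S')$ of $(\mathbb N,E)$ on $\mathcal K\supseteq\mathcal H$ is a dilation of $(\mathcal V,\mathcal S)$ (on $\mathcal H$) if $S_\mu V_p=P_{\mathcal H}S'_\mu V'_p|_{\mathcal H}$ for all $\mu\in E^*$, $p\in\mathbb N$; it is non-trivial if it is not of the form $(\mathcal V,\mathcal S)\oplus\sigma$. *)

(* Defs.v *)
From HB Require Import structures.
From mathcomp Require Import all_boot all_order all_algebra all_fingroup.
From mathcomp Require Import complex.
From mathcomp Require Import all_classical all_reals all_analysis.

Set Implicit Arguments.
Unset Strict Implicit.
Unset Printing Implicit Defensive.

Import Order.TTheory GRing.Theory Num.Theory.
Import numFieldNormedType.Exports.

Local Open Scope classical_set_scope.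
Local Open Scope ring_scope.
Local Open Scope complex_scope.

(* Complex Hilbert spaces. The inner product [hdot] is linear in its first
   argument and conjugate-linear in the second. *)
HB.mixin Record CompleteNormedModule_isHilbert (R : realType) H
    & CompleteNormedModule R[i] H := {
  hdot : {dot H for (@Num.conj R[i])};
  hdot_norm : forall x : H, hdot x x = `|x| ^+ 2
}.

#[short(type="hilbertType")]
HB.structure Definition Hilbert (R : realType) :=
  {H of CompleteNormedModule R[i] H & CompleteNormedModule_isHilbert R H}.

Section Operators.
Variable R : realType.
Implicit Types H K : hilbertType R.

(* For a bounded linear [T] the defining property determines [adjoint T y]
   (Riesz); [0] is returned only when no such vector exists. *)
Definition adjoint H K (T : H -> K) (y : K) : H :=
  xget 0 [set z : H | forall x, hdot (T x) y = hdot x z].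

Definition is_isometry H K (T : H -> K) := forall x, `|T x| = `|x|.

Definition is_projection H (P : H -> H) :=
  (forall x, P (P x) = P x) /\ (forall x y, hdot (P x) y = hdot x (P y)).

(* The order of R[i] compares only numbers with the same imaginary part. *)
Definition op_le H (A B : H -> H) := forall x, hdot (A x) x <= hdot (B x) x.

Definition closed_span H (A : set H) : set H :=
  closure [set x | exists n (c : 'I_n -> R[i]) (a : 'I_n -> H),
             (forall k, A (a k)) /\ x = \sum_(k < n) c k *: a k].

Definition orthonormal_basis H (I : Type) (b : I -> H) :=
  [/\ forall i, hdot (b i) (b i) = 1,
      forall i j, i <> j -> hdot (b i) (b j) = 0 &
      closed_span (range b) = setT].

(* A multiple of the unilateral shift: H has an orthonormal basis b a n
   (a in A, n in nat), and T is the unilateral shift on each copy of l^2(N). *)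
Definition pure_isometry H (T : H -> H) :=
  is_isometry T /\
  exists (A : Type) (b : A -> nat -> H),
    orthonormal_basis (fun x : A * nat => b x.1 x.2) /\
    forall a n, T (b a n) = b a n.+1.

(* H is the Hilbert space direct sum of the ranges of the isometries W i *)
Definition hilbert_sum H (I : Type) (L : I -> hilbertType R)
    (W : forall i, {linear L i -> H}) :=
  [/\ forall i, is_isometry (W i),
      forall i j x y, i <> j -> hdot (W i x) (W j y) = 0 &
      closed_span [set x | exists i y, x = W i y] = setT].

End Operators.

Record digraph := Digraph {
  vertex : finType;
  edge : finType;
  rg : edge -> vertex;
  sr : edge -> vertex
}.

Definition source_free (E : digraph) := forall v : vertex E, exists e, rg e = v.

Definition cell (E : digraph) := (vertex E + edge E)%type.

Record graph_aut (E : digraph) := GraphAut {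
  aut_vertex : {perm vertex E};
  aut_edge : {perm edge E};
  aut_rg : forall e, rg (aut_edge e) = aut_vertex (rg e);
  aut_sr : forall e, sr (aut_edge e) = aut_vertex (sr e)
}.

Definition aut_cell E (g : graph_aut E) (x : cell E) : cell E :=
  match x with
  | inl v => inl (aut_vertex g v)
  | inr e => inr (aut_edge g e)
  end.

Record self_similar (E : digraph) := SelfSimilar {
  ss_act : nat -> graph_aut E;
  ss_res : nat -> cell E -> nat;
  ss_actD : forall p q x,
    aut_cell (ss_act (p + q)%N) x = aut_cell (ss_act p) (aut_cell (ss_act q) x);
  ss_resD : forall p q x,
    ss_res (p + q)%N x = (ss_res p (aut_cell (ss_act q) x) + ss_res q x)%N;
  ss_res_vertex : forall p v, ss_res p (inl v) = p;
  ss_res0_edge : forall e, ss_res 0 (inr e) = 0%N;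
  ss_act_res : forall p e,
    aut_vertex (ss_act (ss_res p (inr e))) (sr e) = aut_vertex (ss_act p) (sr e)
}.

Section SelfSimilarGraph.
Variables (E : digraph) (G : self_similar E).

Definition actv p (v : vertex E) : vertex E := aut_vertex (ss_act G p) v.
Definition acte p (e : edge E) : edge E := aut_edge (ss_act G p) e.
Definition actc p (x : cell E) : cell E := aut_cell (ss_act G p) x.
Definition rese p (e : edge E) : nat := ss_res G p (inr e).

(* The finite path e_1 ... e_k is stored as its range r(e_1) and the sequence
   [:: e_1; ...; e_k]; the vertex v is stored as (v, [::]). *)
Fixpoint is_path (v : vertex E) (es : seq (edge E)) : bool :=
  if es is e :: es' then (rg e == v) && is_path (sr e) es' else true.

Record epath := EPath {
  path_rg : vertex E;
  path_edges : seq (edge E);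
  path_valid : is_path path_rg path_edges
}.

Definition path_sr (m : epath) : vertex E :=
  last (path_rg m) (map (@sr E) (path_edges m)).

Fixpoint act_edges p (es : seq (edge E)) : seq (edge E) :=
  if es is e :: es' then acte p e :: act_edges (rese p e) es' else [::].

Fixpoint res_edges p (es : seq (edge E)) : nat :=
  if es is e :: es' then res_edges (rese p e) es' else p.

Lemma act_edges_valid p v es :
  is_path v es -> is_path (actv p v) (act_edges p es).
Proof.
elim: es p v => [//|e es IH] p v /= /andP[/eqP <- vs].
rewrite /acte aut_rg eqxx /= aut_sr -ss_act_res.
exact: IH.
Qed.

Definition act_path p (m : epath) : epath :=
  EPath (act_edges_valid p (path_valid m)).

Definition res_path p (m : epath) : nat := res_edges p (path_edges m).

Lemma cons_valid (e : edge E) (m : epath) :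
  sr e = path_rg m -> is_path (rg e) (e :: path_edges m).
Proof. by move=> /= ->; rewrite eqxx path_valid. Qed.

Definition cons_path (e : edge E) (m : epath) (h : sr e = path_rg m) : epath :=
  EPath (cons_valid h).

Section Families.
Variables (R : realType) (H : hilbertType R).
Implicit Types (V : nat -> {linear H -> H}) (S : cell E -> {linear H -> H}).

Definition range_sum S (v : vertex E) (x : H) : H :=
  \sum_(e | rg e == v) S (inr e) (adjoint (S (inr e)) x).

Record TCK_family S : Prop := {
  tck_proj : forall v, is_projection (S (inl v));
  tck_orth : forall v w x, v <> w -> S (inl v) (S (inl w) x) = 0;
  tck_bounded : forall e, continuous (S (inr e));
  tck_source : forall e x,
    adjoint (S (inr e)) (S (inr e) x) = S (inl (sr e)) x;
  tck_range : forall v, op_le (range_sum S v) (S (inl v));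
  tck_nondeg : forall x, \sum_v S (inl v) x = x
}.

Definition CK_family S :=
  TCK_family S /\ forall v x, range_sum S v x = S (inl v) x.

Record representation V S : Prop := {
  rep_isometry : forall p, is_isometry (V p);
  rep_add : forall p q x, V (p + q)%N x = V p (V q x);
  rep_0 : forall x, V 0%N x = x;
  rep_tck : TCK_family S;
  rep_comm : forall p m x, V p (S m x) = S (actc p m) (V (ss_res G p m) x);
  rep_comm_adj : forall p m x,
    adjoint (V p) (S (actc p m) x) = S m (adjoint (V (ss_res G p m)) x)
}.

Definition pure_CK_type V S := pure_isometry (V 1%N) /\ CK_family S.

Definition op_path S (m : epath) (x : H) : H :=
  if path_edges m is [::] then S (inl (path_rg m)) x
  else foldr (fun e y => S (inr e) y) x (path_edges m).

(* H is l^2(E^* x N) with standard basis d, and (V, S) is the left regular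
   representation on it *)
Record left_regular_model (d : epath -> nat -> H) V S : Prop := {
  lrm_basis : orthonormal_basis (fun x : epath * nat => d x.1 x.2);
  lrm_bounded : forall m, continuous (S m);
  lrm_isometry : forall q, is_isometry (V q);
  lrm_V : forall q m p, V q (d m p) = d (act_path q m) (res_path q m + p)%N;
  lrm_vertex : forall v m p,
    S (inl v) (d m p) = if v == path_rg m then d m p else 0;
  lrm_edge : forall e m p (h : sr e = path_rg m),
    S (inr e) (d m p) = d (cons_path h) p;
  lrm_edge0 : forall e m p, sr e <> path_rg m -> S (inr e) (d m p) = 0
}.

End Families.

Section Representations.
Variable R : realType.

Definition intertwines (H K : hilbertType R) (W : {linear H -> K})
    (V : nat -> {linear H -> H}) (S : cell E -> {linear H -> H})
    (V' : nat -> {linear K -> K}) (S' : cell E -> {linear K -> K}) :=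
  (forall p x, W (V p x) = V' p (W x)) /\
  (forall m x, W (S m x) = S' m (W x)).

(* (V, S) is unitarily equivalent to the restriction of the left regular
   representation to the closed span of the d_{mu,p} with s(mu) = p.v *)
Definition is_lambda (v : vertex E) (H : hilbertType R)
    (V : nat -> {linear H -> H}) (S : cell E -> {linear H -> H}) :=
  exists (M : hilbertType R) (d : epath -> nat -> M)
      (LV : nat -> {linear M -> M}) (LS : cell E -> {linear M -> M})
      (U : {linear H -> M}),
    [/\ left_regular_model d LV LS,
        is_isometry U,
        range U = closed_span
          [set x | exists m p, path_sr m = actv p v /\ x = d m p] &
        intertwines U V S LV LS].

(* The amplification of lambda_v is the direct sum of copies of lambda_v
   indexed by a set A v. *)
Definition left_regular (H : hilbertType R)
    (V : nat -> {linear H -> H}) (S : cell E -> {linear H -> H}) :=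
  exists (A : vertex E -> Type) (L : {v & A v} -> hilbertType R)
      (LV : forall i, nat -> {linear L i -> L i})
      (LS : forall i, cell E -> {linear L i -> L i})
      (W : forall i, {linear L i -> H}),
    [/\ forall i, is_lambda (projT1 i) (LV i) (LS i),
        hilbert_sum W &
        forall i, intertwines (W i) (LV i) (LS i) V S].

(* The isometry J plays the role of the inclusion of H in K, and [adjoint J]
   that of the projection P_H of K onto H. *)
Definition is_dilation (H K : hilbertType R) (J : {linear H -> K})
    (V : nat -> {linear H -> H}) (S : cell E -> {linear H -> H})
    (V' : nat -> {linear K -> K}) (S' : cell E -> {linear K -> K}) :=
  [/\ is_isometry J, representation V' S' &
      forall m p x,
        op_path S m (V p x) = adjoint J (op_path S' m (V' p (J x)))].

(* (V', S') = (V, S) (+) sigma, for some representation sigma on the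
   orthogonal complement of the range of J *)
Definition trivial_dilation (H K : hilbertType R) (J : {linear H -> K})
    (V : nat -> {linear H -> H}) (S : cell E -> {linear H -> H})
    (V' : nat -> {linear K -> K}) (S' : cell E -> {linear K -> K}) :=
  exists (L : hilbertType R) (J' : {linear L -> K})
      (VL : nat -> {linear L -> L}) (SL : cell E -> {linear L -> L}),
    [/\ representation VL SL,
        is_isometry J',
        (forall x z, hdot (J x) (J' z) = 0) /\
        (forall y, exists x z, y = J x + J' z),
        intertwines J V S V' S' &
        intertwines J' VL SL V' S'].

End Representations.
End SelfSimilarGraph.

(* Main.v *)
Require Import Defs.
From HB Require Import structures.
From mathcomp Require Import all_boot all_order all_algebra all_fingroup.
From mathcomp Require Import complex ring lra.
From mathcomp Require Import all_classical all_reals all_analysis.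

(* Idea: V_1 is not surjective, and every representation (V, S) dilates to one
   whose V'_1 is unitary, which cannot split as (V, S) (+) sigma.
   A vector x of the space K of the minimal unitary extension U of V_1 is
   recorded by its coordinates x_n = P_H U^n x, i.e. by a bounded sequence with
   V_1^* x_{n+1} = x_n, and <x, y> = lim <x_n, y_n>.  In these coordinates U is
   the shift, and S'_mu has to be (S'_mu x)_n = S_{n.mu} x_{n|mu}; this sequence
   is coherent because V_1^* S_{1.mu} = S_mu V_{1|mu}^*.  The relations of
   (V, S) pass to the limit; the relation S'_e^* S'_e = S'_{s(e)} also needs
   n|_e -> oo, which follows from the assumption on restrictions. *)

Set Implicit Arguments.
Unset Strict Implicit.
Unset Printing Implicit Defensive.

Import Order.TTheory GRing.Theory Num.Theory.
Import numFieldNormedType.Exports.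

Local Open Scope classical_set_scope.
Local Open Scope ring_scope.
Local Open Scope complex_scope.

(* [Re] alone would be the real part of an abstract closed field. *)
Local Notation Re := complex.Re.

(** * Inner products, Riesz representation and adjoints *)

Section InnerProduct.
Variables (R : realType) (H : hilbertType R).
Implicit Types (x y z : H) (c : R[i]).

Lemma hdotC x y : hdot x y = Num.conj (hdot y x).
Proof. by rewrite hermC expr0 mul1r. Qed.

Lemma hdotDl x y z : hdot (x + y) z = hdot x z + hdot y z.
Proof. exact: linearDl. Qed.

Lemma hdotBl x y z : hdot (x - y) z = hdot x z - hdot y z.
Proof. exact: linearBl. Qed.

Lemma hdotZl c x y : hdot (c *: x) y = c * hdot x y.
Proof. exact: linearZl_LR. Qed.

Lemma hdot0l x : hdot 0 x = 0.
Proof. exact: linear0l. Qed.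

Lemma hdotDr x y z : hdot z (x + y) = hdot z x + hdot z y.
Proof. exact: linearDr. Qed.

Lemma hdotBr x y z : hdot z (x - y) = hdot z x - hdot z y.
Proof. exact: linearBr. Qed.

Lemma hdotZr c x y : hdot x (c *: y) = Num.conj c * hdot x y.
Proof. exact: linearZr_LR. Qed.

Lemma hdot0r x : hdot x 0 = 0.
Proof. exact: linear0r. Qed.

Lemma hdot_suml (I : Type) (r : seq I) (P : pred I) (F : I -> H) y :
  hdot (\sum_(i <- r | P i) F i) y = \sum_(i <- r | P i) hdot (F i) y.
Proof.
exact: (big_morph (fun x => hdot x y) (fun _ _ => hdotDl _ _ _) (hdot0l y)).
Qed.

Lemma hdot_sumr (I : Type) (r : seq I) (P : pred I) (F : I -> H) x :
  hdot x (\sum_(i <- r | P i) F i) = \sum_(i <- r | P i) hdot x (F i).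
Proof. exact: (big_morph (hdot x) (fun _ _ => hdotDr _ _ _) (hdot0r x)). Qed.

Lemma hdot_ge0 x : 0 <= hdot x x.
Proof. by rewrite hdot_norm exprn_ge0. Qed.

Lemma hdot_eq0 x : hdot x x = 0 -> x = 0.
Proof. by rewrite hdot_norm => /eqP; rewrite sqrf_eq0 normr_eq0 => /eqP. Qed.

Lemma hdot_inj y z : (forall x, hdot x y = hdot x z) -> y = z.
Proof.
move=> e; apply/eqP; rewrite -subr_eq0; apply/eqP/hdot_eq0.
by rewrite hdotBr e subrr.
Qed.

(** Expand the squared norm of [x] minus its orthogonal projection onto the line of [y]. *)
Lemma cauchy_schwarz x y : `|hdot x y| <= `|x| * `|y|.
Proof.
have [->|y0] := eqVneq y 0; first by rewrite hdot0r !normr0 mulr0.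
have ny : `|y| != 0 by rewrite normr_eq0.
rewrite -(@ler_pXn2r _ 2) ?nnegrE ?mulr_ge0//.
have := hdot_ge0 (x - (hdot x y / `|y| ^+ 2) *: y).
rewrite hdotBl !hdotBr !hdotZl !hdotZr -!hdot_norm [hdot y x]hdotC.
rewrite rmorphM/= fmorphV/= -[Num.conj (hdot y y)]hdotC hdot_norm.
set a := hdot x y; rewrite hdot_norm => h.
have {h} : 0 <= `|x| ^+ 2 - (a * Num.conj a) / `|y| ^+ 2.
  by apply: (le_trans h); rewrite le_eqVlt; apply/orP; left; apply/eqP; field.
rewrite -normCK subr_ge0 ler_pdivrMr ?exprn_gt0 ?normr_gt0//.
by rewrite exprMn.
Qed.

End InnerProduct.

Section RealParts.
Variable R : realType.
Implicit Types z w : R[i].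

Lemma ReD z w : Re (z + w) = Re z + Re w.
Proof. by case: z w => [a b] [c d]. Qed.

Lemma ReN z : Re (- z) = - Re z.
Proof. by case: z. Qed.

Lemma ReM_real (t : R) z : Re (t%:C * z) = t * Re z.
Proof. by case: z => a b /=; rewrite mul0r subr0. Qed.

Lemma Re_conj z : Re (Num.conj z) = Re z.
Proof. by case: z. Qed.

Lemma conj_realC (t : R) : Num.conj (t%:C) = t%:C.
Proof. by rewrite /Num.conj /= oppr0. Qed.

Lemma conj_i : Num.conj (0 +i* 1 : R[i]) = - (0 +i* 1).
Proof. by rewrite /Num.conj /=; congr Complex; rewrite oppr0. Qed.

(** Since [Re (i z) = - Im z], an identity between complex-linear expressions follows from its real
    part, applied also after multiplication by [i]. *)
Lemma complex_eqRe z w :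
  Re z = Re w -> Re ((0 +i* 1) * z) = Re ((0 +i* 1) * w) -> z = w.
Proof.
case: z w => [a b] [c d] /= ->; rewrite !mul0r !mul1r !sub0r.
by move=> /oppr_inj ->.
Qed.

Lemma ger0_realC z : 0 <= z -> z = (Re z)%:C.
Proof. by case: z => a b; rewrite lecE /= => /andP[/eqP ->]. Qed.

End RealParts.

Section Norms.
Variables (R : realType) (H : hilbertType R).
Implicit Types x y : H.

(** Norms take values in [R[i]]; this real version makes [lra], [nra], suprema and monotone limits
    available. *)
Definition nrm x : R := Re `|x|.

Lemma norm_nrm x : `|x| = (nrm x)%:C.
Proof. exact/ger0_realC/normr_ge0. Qed.

Lemma nrm_ge0 x : 0 <= nrm x.
Proof. by have := normr_ge0 x; rewrite norm_nrm ler0c. Qed.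

Lemma nrmE x : Re (hdot x x) = nrm x ^+ 2.
Proof. by rewrite hdot_norm norm_nrm -rmorphXn. Qed.

Lemma hdotxx x : hdot x x = (nrm x ^+ 2)%:C.
Proof. by rewrite hdot_norm norm_nrm rmorphXn. Qed.

Lemma nrmZ (c : R[i]) x : nrm (c *: x) = Re `|c| * nrm x.
Proof. by rewrite /nrm normrZ (ger0_realC (normr_ge0 c)) ReM_real. Qed.

Lemma nrm_leD x y : nrm (x + y) <= nrm x + nrm y.
Proof. by have := ler_normD x y; rewrite !norm_nrm -rmorphD lecR. Qed.

Lemma Re_hdot_le x y : `|Re (hdot x y)| <= nrm x * nrm y.
Proof.
rewrite -lecR rmorphM/= -!norm_nrm.
exact: le_trans (normc_ge_Re _) (cauchy_schwarz _ _).
Qed.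

Lemma Re_hdotC x y : Re (hdot x y) = Re (hdot y x).
Proof. by rewrite hdotC Re_conj. Qed.

End Norms.

Section Riesz.
Variables (R : realType) (H : hilbertType R).
Implicit Types x y : H.

Lemma nrm_sqr_line x y (t : R) :
  nrm (x + t%:C *: y) ^+ 2
  = nrm x ^+ 2 + 2 * t * Re (hdot x y) + t ^+ 2 * nrm y ^+ 2.
Proof.
rewrite -!nrmE hdotDl !hdotDr !hdotZl !hdotZr conj_realC !ReD !ReM_real.
by rewrite (Re_hdotC y x); ring.
Qed.

Variables (g : H -> R) (C : R).
Hypotheses (gD : forall x y, g (x + y) = g x + g y).
Hypotheses (gZ : forall (t : R) x, g (t%:C *: x) = t * g x).
Hypotheses (g_le : forall x, `|g x| <= C * nrm x).

Let q x : R := nrm x ^+ 2 - 2 * g x.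

Let q_line x y t :
  q (x + t%:C *: y)
  = q x + 2 * t * (Re (hdot x y) - g y) + t ^+ 2 * nrm y ^+ 2.
Proof. by rewrite /q nrm_sqr_line gD gZ; ring. Qed.

Let has_inf_q : has_inf (range q).
Proof.
split; first by exists (q 0), 0.
exists (- C ^+ 2) => _ [x _ <-]; rewrite /q.
have := g_le x; rewrite ler_norml => /andP[_ h].
have : 0 <= (nrm x - C) ^+ 2 by apply: sqr_ge0.
by nra.
Qed.

Let I := inf (range q).
Let I_le x : I <= q x.
Proof. by apply: (ge_inf has_inf_q.2); exists x. Qed.

Let F := filter_from [set e : R | 0 < e] (fun e => [set x | q x < I + e]).

Let F_proper : ProperFilter F.
Proof.
apply: filter_from_proper; last first.
  move=> e e0; have [_ [x _ <-] xe] := inf_adherent e0 has_inf_q.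
  by exists x.
apply: filter_from_filter; first by exists 1 => /=.
move=> a b a0 b0; exists (Order.min a b) => /=; first by rewrite lt_min a0 b0.
move=> x /= h.
by split; apply: (lt_le_trans h); rewrite lerD2l ge_min lexx ?orbT.
Qed.

(** Parallelogram law: at the midpoint, [q] equals the mean of [q a] and [q b] minus a quarter of
    [nrm (a - b) ^+ 2], and this is still at least [I]. *)
Let near_min a b e : q a < I + e -> q b < I + e -> nrm (a - b) ^+ 2 <= 4 * e.
Proof.
move=> qa qb.
have := I_le (b + (2^-1)%:C *: (a - b)).
have := q_line b (a - b) 1.
rewrite scale1r [b + _]addrC subrK q_line.
by move: (Re _) (g (a - b)) => r s h1 h2; lra.
Qed.

Let near_crit w y e : q w < I + e ->
  (Re (hdot w y) - g y) ^+ 2 <= e * (nrm y ^+ 2 + 1).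
Proof.
move=> qw; set s := _ - _; set N := nrm y ^+ 2.
have N0 : 0 <= N by apply: sqr_ge0.
(* A step against the slope [s]: with [u = s / (N + 1)] it lowers [q] by [u ^+ 2 * (N + 2)], which
   cannot exceed [e]. The [+ 1] keeps the quotient meaningful for [y = 0]. *)
have := I_le (w + (- (s / (N + 1)))%:C *: y).
rewrite q_line -/s -/N; set u := s / (N + 1).
have su : s = u * (N + 1) by rewrite /u divfK// gt_eqF// ltr_wpDl.
rewrite su => h.
have h2 : u ^+ 2 * (N + 2) <= e by nra.
have -> : (u * (N + 1)) ^+ 2 = (u ^+ 2 * (N + 1)) * (N + 1) by ring.
apply: ler_wpM2r; first by rewrite addr_ge0.
by apply: le_trans h2; rewrite ler_wpM2l ?sqr_ge0// lerD2l ler1n.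
Qed.

(* [z] minimises [|x|^2 - 2 g x]: minimising filters are Cauchy by
   [near_min], and the derivative at the minimum is [2 (Re <z, y> - g y)]. *)
Lemma riesz_real : exists z, forall x, g x = Re (hdot x z).
Proof.
have FF : ProperFilter F := F_proper.
have Fc : cauchy F.
  apply: (@cauchy_exP R[i] H F) => eps eps0.
  have e0 : 0 < Re eps by rewrite -ltcR -ger0_realC ?ltW.
  (* With this [e], [near_min] bounds distances by half of [Re eps]. *)
  pose e := (Re eps / 4) ^+ 2 .
  have ee : 0 < e by rewrite exprn_gt0// divr_gt0.
  have [_ [b _ <-] xb] := inf_adherent ee has_inf_q.
  exists b; exists e => //= a qa.
  rewrite -ball_normE /ball_/= (ger0_realC (ltW eps0)) norm_nrm ltcR.
  have := near_min xb qa; rewrite /e => h.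
  rewrite -(@ltr_pXn2r _ 2) ?nnegrE ?nrm_ge0 ?ltW//.
  have := exprn_gt0 2 e0; move: (Re eps) h => r h r0.
  by apply: (le_lt_trans h); lra.
have /cvg_ex[z Fz] := @cauchy_cvg _ _ FF Fc.
exists z => y; rewrite Re_hdotC; apply/eqP.
rewrite -subr_eq0 -sqrf_eq0 eq_le sqr_ge0 andbT.
apply/ler_addgt0Pr => d d0; rewrite add0r.
set N := nrm y ^+ 2; have N0 : 0 <= N by apply: sqr_ge0.
have N1 : 0 < 4 * N + 2 by apply: ltr_wpDl => //; rewrite mulr_ge0.
(* The final estimate is twice [e * (N + 1)], from [near_crit], plus twice [e * N], from
   Cauchy-Schwarz; together they give [d]. *)
pose e := d / (4 * N + 2); have e0 : 0 < e by rewrite divr_gt0.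
have c0 : 0 < Num.sqrt e by rewrite sqrtr_gt0.
have Fq : F [set x | q x < I + e] by exists e.
have cC : (0 : R[i]) < (Num.sqrt e)%:C by rewrite ltcR.
have /fcvgrPdist_lt/(_ _ cC) Fd := Fz.
have [w [/= qw]] := filter_ex (filterI Fq Fd).
rewrite norm_nrm ltcR => zw.
have h1 := near_crit y qw.
have h2 : nrm (z - w) ^+ 2 <= e.
  by rewrite -(sqr_sqrtr (ltW e0)) ler_pXn2r ?nnegrE ?nrm_ge0 ?ltW.
have h3 : Re (hdot (z - w) y) ^+ 2 <= e * N.
  rewrite -real_normK ?num_real//.
  apply: (@le_trans _ _ ((nrm (z - w) * nrm y) ^+ 2)).
    by rewrite ler_pXn2r ?nnegrE ?mulr_ge0 ?nrm_ge0 ?Re_hdot_le.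
  by rewrite exprMn ler_wpM2r ?sqr_ge0.
have -> : d = e * (4 * N + 2) by rewrite /e divfK// gt_eqF.
move: h1 h3; rewrite hdotBl ReD ReN -/N.
move: (Re _) (Re _) (g y) => p r k h1 h3.
have : 0 <= ((r - k) - (p - r)) ^+ 2 by apply: sqr_ge0.
have -> : (k - p) ^+ 2 = ((r - k) + (p - r)) ^+ 2 by ring.
by nra.
Qed.

End Riesz.

Section Adjoint.
Variables (R : realType) (H K : hilbertType R) (T : {linear H -> K}).
Implicit Types (x z : H) (y : K).

Lemma adjoint_eq y z : (forall x, hdot (T x) y = hdot x z) -> adjoint T y = z.
Proof.
move=> hz; apply: hdot_inj => x; rewrite -hz.
pose Z := [set z | forall x, hdot (T x) y = hdot x z].
by have /= -> := xgetPex 0 (ex_intro Z z hz).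
Qed.

Lemma bounded_adjointE (C : R) : (forall x, nrm (T x) <= C * nrm x) ->
  forall x y, hdot (T x) y = hdot x (adjoint T y).
Proof.
move=> TC x y.
have [|||z hz] := @riesz_real R H (fun x => Re (hdot (T x) y)) (C * nrm y).
- by move=> a b; rewrite linearD hdotDl ReD.
- by move=> t a; rewrite linearZ hdotZl ReM_real.
- move=> a; apply: (le_trans (Re_hdot_le _ _)).
  by rewrite mulrAC ler_wpM2r ?nrm_ge0.
suff hz' x' : hdot (T x') y = hdot x' z by rewrite (adjoint_eq hz').
(* Riesz was applied to the real part only; evaluating at [i x'] recovers the imaginary part. *)
apply: complex_eqRe; first exact: hz.
by rewrite -!hdotZl -linearZ hz.
Qed.

Lemma continuous_adjointE : continuous T ->
  forall x y, hdot (T x) y = hdot x (adjoint T y).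
Proof.
move=> /linear_bounded_continuous/linear_boundedP Tb.
have [r [r0 Tr]] := pinfty_ex_gt0 Tb.
apply: (@bounded_adjointE (Re r)) => x.
by rewrite -lecR rmorphM/= -(ger0_realC (ltW r0)) -!norm_nrm.
Qed.

(** Polarisation: [|T (a + b)|] gives the real parts, and replacing [x] by [i x] the imaginary
    ones. *)
Lemma isometry_hdot : is_isometry T ->
  forall x x', hdot (T x) (T x') = hdot x x'.
Proof.
move=> Ti x x'.
have nT a : hdot (T a) (T a) = hdot a a by rewrite !hdot_norm Ti.
have ReT a b : Re (hdot (T a) (T b)) = Re (hdot a b).
  have := nT (a + b); rewrite linearD !hdotDl !hdotDr !nT.
  move=> /(congr1 (@complex.Re R)).
  rewrite !ReD (Re_hdotC (T b) (T a)) (Re_hdotC b a); lra.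
by apply: complex_eqRe; rewrite // -!hdotZl -linearZ.
Qed.

Lemma isometry_adjointE : is_isometry T ->
  forall x y, hdot (T x) y = hdot x (adjoint T y).
Proof.
by move=> Ti; apply: (@bounded_adjointE 1) => x; rewrite mul1r /nrm Ti.
Qed.

Lemma isometry_adjointK : is_isometry T -> forall x, adjoint T (T x) = x.
Proof. by move=> Ti x; apply: adjoint_eq => a; apply: isometry_hdot. Qed.

End Adjoint.

Lemma contraction_continuous (R : realType) (H K : hilbertType R)
  (T : {linear H -> K}) : (forall x, nrm (T x) <= nrm x) -> continuous T.
Proof.
move=> Tc; apply/linear_bounded_continuous/linear_boundedP.
near=> r => x.
apply: (@le_trans _ _ `|x|); first by rewrite !norm_nrm lecR.
rewrite ler_peMl//; near: r.
Unshelve. all: by end_near. Qed.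

(** * Limits of inner products and norms along a filter *)

Section Limits.
Variables (R : realType) (H : hilbertType R).
Variables (I : Type) (F : set_system I).
Context {FF : ProperFilter F}.
Implicit Types u : I -> H.
Local Notation C := (R[i] : numFieldType).

Lemma hdot_cvgl u (l y : H) :
  u @ F --> l -> (fun i => hdot (u i) y) @ F --> hdot l y.
Proof.
move=> ul; apply/cvgrPdist_lt => e e0.
have y0 : 0 < `|y| + 1 by rewrite ltr_wpDl.
have /cvgrPdist_lt/(_ _ (divr_gt0 e0 y0)) := ul.
apply: filterS => i ui; rewrite -hdotBl.
apply: (le_lt_trans (cauchy_schwarz _ _)).
apply: (@le_lt_trans _ _ (`|l - u i| * (`|y| + 1))).
  by rewrite ler_wpM2l// lerDl.
by rewrite -ltr_pdivlMr.
Qed.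

Lemma hdot_cvgr u (l y : H) :
  u @ F --> l -> (fun i => hdot y (u i)) @ F --> hdot y l.
Proof.
move=> ul; apply/cvgrPdist_lt => e e0.
have /cvgrPdist_lt/(_ _ e0) := hdot_cvgl (y := y) ul.
apply: filterS => i; rewrite -hdotBl -hdotBr.
by rewrite [hdot y _]hdotC norm_conjC.
Qed.

Lemma nrm_dist_cvg_le u (l a : H) (M : R) : u @ F --> l ->
  (\forall i \near F, nrm (u i - a) <= M) -> nrm (l - a) <= M.
Proof.
move=> ul uM; apply/ler_addgt0Pr => d d0.
have dC : (0 : R[i]) < d%:C by rewrite ltcR.
have /cvgrPdist_lt/(_ _ dC) ud := ul.
have [i [iM id]] := filter_ex (filterI uM ud).
rewrite norm_nrm ltcR in id.
rewrite -[l - a](subrKA (u i)) addrC; apply: (le_trans (nrm_leD _ _)).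
by rewrite lerD// ltW.
Qed.

Lemma complex_cvg_unique (u : I -> C) (a b : C) :
  u @ F --> a -> u @ F --> b -> a = b.
Proof. by move=> ua ub; rewrite -(cvg_lim _ ua)// -(cvg_lim _ ub). Qed.

Lemma real_complex_cvg (u : I -> R) (l : R) :
  u @ F --> l ->
  (fun i => (u i)%:C : C) @ F --> (l%:C : C).
Proof.
move=> ul; apply/cvgrPdist_lt => e e0.
have e1 : 0 < Re e by rewrite -ltcR -ger0_realC ?ltW.
have /cvgrPdist_lt/(_ _ e1) := ul.
apply: filterS => i ui.
rewrite -rmorphB normc_def/= expr0n addr0 sqrtr_sqr.
by rewrite (ger0_realC (ltW e0)) ltcR.
Qed.

End Limits.
Arguments hdot_cvgl {R H I F FF u l} y _.
Arguments hdot_cvgr {R H I F FF u l} y _.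

(** * The space of the unitary extension of an isometry *)

Section UnitarySpace.
Variables (R : realType) (H : hilbertType R) (T : {linear H -> H}).

(** The first clause is the weak form of [T^* x_{n+1} = x_n]; in this form it visibly passes to
    linear combinations and limits. *)
Definition coherent (x : nat -> H) :=
  (forall n h, hdot (T h) (x n.+1) = hdot h (x n)) /\
  exists M, forall n, nrm (x n) <= M.

Definition coherent_pred : {pred nat -> H} := [pred x | `[< coherent x >]].

Lemma coherentP x : reflect (coherent x) (x \in coherent_pred).
Proof. exact: asboolP. Qed.

Lemma coherent_submod : submod_closed coherent_pred.
Proof.
split => [|c x y].
  apply/coherentP; split => [n h|]; first by rewrite !hdot0r.
  by exists 0 => n; rewrite /nrm normr0.
move=> /coherentP[xT [M xM]] /coherentP[yT [N yN]]; apply/coherentP.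
split => [n h|].
  by rewrite !hdotDr !hdotZr xT yT.
exists (Re `|c| * M + N) => n; apply: (le_trans (nrm_leD _ _)).
rewrite lerD// nrmZ ler_wpM2l// -ler0c -ger0_realC //.
Qed.

HB.instance Definition _ :=
  GRing.isSubmodClosed.Build R[i] (nat -> H) coherent_pred coherent_submod.

(* [Ti] is not used by the fields: it is a parameter so that the inner product,
   whose existence depends on it, can be attached to the type. *)
Record unitary_space (Ti : is_isometry T) := UnitarySpace {
  coord_seq :> nat -> H;
  coord_seqP : coord_seq \in coherent_pred
}.

Variable Ti : is_isometry T.
Local Notation K := (unitary_space Ti).

HB.instance Definition _ := [isSub of K for @coord_seq Ti].
HB.instance Definition _ := [Choice of K by <:].
HB.instance Definition _ := [SubChoice_isSubLmodule of K by <:].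

Implicit Types (x y : K).

Lemma coord_seqD x y n : (x + y) n = x n + y n.
Proof. by []. Qed.

Lemma coord_seqB x y n : (x - y) n = x n - y n.
Proof. by []. Qed.

Lemma coord_seqZ (c : R[i]) x n : (c *: x) n = c *: x n.
Proof. by []. Qed.

Lemma coord_seq0 n : (0 : K) n = 0.
Proof. by []. Qed.

Lemma coord_inj x y : (forall n, x n = y n) -> x = y.
Proof. by move=> xy; apply: val_inj; apply/funext. Qed.

Lemma coord_adj x n h : hdot (T h) (x n.+1) = hdot h (x n).
Proof. by have /coherentP[] := coord_seqP x. Qed.

(** By [nrm_coord_le] this is the limit of the norms, hence the norm of the limiting inner product;
    as a supremum it satisfies the triangle inequality directly. *)
Definition supnorm x := sup (range (fun n => nrm (x n))).

Lemma nrm_le_supnorm x n : nrm (x n) <= supnorm x.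
Proof.
have /coherentP[_ [M xM]] := coord_seqP x.
by apply: ub_le_sup; [exists M => _ [m _ <-] | exists n].
Qed.

Lemma supnorm_le x (M : R) : (forall n, nrm (x n) <= M) -> supnorm x <= M.
Proof.
by move=> xM; apply: ge_sup; [exists (nrm (x 0%N)), 0%N | move=> _ [n _ <-]].
Qed.

Lemma supnorm_ge0 x : 0 <= supnorm x.
Proof. exact: le_trans (nrm_ge0 (x 0%N)) (nrm_le_supnorm x 0). Qed.

Lemma supnormD x y : (supnorm (x + y))%:C <= (supnorm x)%:C + (supnorm y)%:C.
Proof.
rewrite -rmorphD lecR; apply: supnorm_le => n.
by rewrite coord_seqD (le_trans (nrm_leD _ _))// lerD ?nrm_le_supnorm.
Qed.

Lemma supnormZ_le (c : R[i]) x : supnorm (c *: x) <= Re `|c| * supnorm x.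
Proof.
apply: supnorm_le => n; rewrite coord_seqZ nrmZ ler_wpM2l ?nrm_le_supnorm//.
by rewrite -ler0c -ger0_realC.
Qed.

Lemma supnormZ (c : R[i]) x : (supnorm (c *: x))%:C = `|c| * (supnorm x)%:C.
Proof.
rewrite (ger0_realC (normr_ge0 c)) -rmorphM; congr _%:C; apply/eqP.
rewrite eq_le supnormZ_le andTb.
have [c0|c0] := eqVneq c 0.
  by rewrite c0 normr0 mul0r supnorm_ge0.
have c1 : 0 < Re `|c| by rewrite -ltcR -ger0_realC ?normr_gt0.
(* The reverse inequality is [supnormZ_le] for the scalar [c^-1] and the vector [c *: x]. *)
rewrite mulrC -ler_pdivlMr// mulrC -{1}[x](scalerK c0).
apply: (le_trans (supnormZ_le _ _)).
by rewrite normfV {1}(ger0_realC (normr_ge0 c)) -fmorphV.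
Qed.

Lemma supnorm_eq0 x : (supnorm x)%:C = 0 -> x = 0.
Proof.
move=> /(congr1 (@complex.Re R)) /= x0; apply: coord_inj => n.
rewrite coord_seq0.
apply/eqP; rewrite -normr_eq0 norm_nrm; apply/eqP; congr _%:C; apply/eqP.
by rewrite eq_le nrm_ge0 -x0 nrm_le_supnorm.
Qed.

HB.instance Definition _ :=
  Lmodule_isNormed.Build R[i] K supnormD supnormZ supnorm_eq0.

Lemma norm_supnorm x : `|x| = (supnorm x)%:C.
Proof. by []. Qed.

(** Each coordinate map is a contraction, so a Cauchy filter converges coordinatewise; the limit
    sequence is coherent and bounded. *)
Lemma unitary_space_complete (F : set_system K) :
  ProperFilter F -> cauchy F -> cvg F.
Proof.
move=> FF Fc.
have Fex := (@cauchyP R[i] K F FF).1 Fc.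
have Fb (e : R) : 0 < e -> exists x, F [set y | supnorm (x - y) < e].
  move=> e0; have [|x Fx] := Fex e%:C; first by rewrite ltcR.
  exists x; apply: filterS Fx => y.
  by rewrite -ball_normE /ball_/= norm_supnorm ltcR.
have Fn n : cvg ((fun x : K => x n) @ F).
  apply: cauchy_cvg; apply: (@cauchy_exP R[i] H) => e e0.
  have e1 : 0 < Re e by rewrite -ltcR -ger0_realC ?ltW.
  have [x Fx] := Fb _ e1; exists (x n).
  apply: (@filterS _ F _ _ _ _ Fx) => y /=.
  move=> xy; rewrite -ball_normE /ball_/= norm_nrm (ger0_realC (ltW e0)) ltcR.
  by apply: le_lt_trans xy; exact: (nrm_le_supnorm (x - y) n).
pose z n : H := lim ((fun x : K => x n) @ F).
have Fz n : (fun x : K => x n) @ F --> z n by exact: Fn.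
(* The bound does not depend on [n], which upgrades coordinatewise convergence to convergence in
   [supnorm]. *)
have near_z (x : K) (e : R) : F [set y | supnorm (x - y) < e] ->
    forall n, nrm (z n - x n) <= e.
  move=> Fx n; apply: (nrm_dist_cvg_le (Fz n)).
  apply: (@filterS _ F _ _ _ _ Fx) => y /= xy; rewrite /nrm -opprB normrN.
  by apply: le_trans (ltW xy); exact: (nrm_le_supnorm (x - y) n).
have zc : z \in coherent_pred.
  apply/coherentP; split=> [n h|].
    have h1 := hdot_cvgr (FF := FF) (T h) (Fz n.+1).
    have h2 := hdot_cvgr (FF := FF) h (Fz n).
    have e : (fun x : K => hdot h (x n)) =
             (fun x : K => hdot (T h) (x n.+1)).
      by apply/funext => x; rewrite coord_adj.
    by move: h2; rewrite e; apply: complex_cvg_unique h1.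
  have [x Fx] := Fb 1 ltr01; exists (1 + supnorm x) => n.
  rewrite -[z n](subrK (x n)); apply: (le_trans (nrm_leD _ _)).
  by rewrite lerD ?nrm_le_supnorm ?near_z.
apply/cvg_ex; exists (UnitarySpace Ti zc).
apply/fcvgrPdist_lt => e e0.
have e1 : 0 < Re e / 2 by rewrite divr_gt0// -ltcR -ger0_realC ?ltW.
have [x Fx] := Fb _ e1; apply: (@filterS _ F _ _ _ _ Fx) => y /=.
move=> xy; rewrite norm_supnorm (ger0_realC (ltW e0)) ltcR.
apply: (@le_lt_trans _ _ (Re e / 2 + supnorm (x - y))); last first.
  by rewrite [ltRHS](splitr (Re e)) ltrD2l.
apply: supnorm_le => n; rewrite coord_seqB -(subrKA (x n)).
apply: (le_trans (nrm_leD _ _)); apply: lerD; first exact: (near_z _ _ Fx).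
exact: (nrm_le_supnorm (x - y) n).
Qed.

HB.instance Definition _ := Uniform_isComplete.Build K unitary_space_complete.

(** Coherence turns [nrm (x n) ^+ 2] into the inner product of [T (x n)] with [x n.+1], and [T]
    preserves norms. *)
Lemma nrm_coord_le x n : nrm (x n) <= nrm (x n.+1).
Proof.
have [->|xn] := eqVneq (x n) 0; first by rewrite /nrm normr0 nrm_ge0.
have x0 : 0 < nrm (x n) by rewrite -ltcR -norm_nrm normr_gt0.
rewrite -(ler_pM2l x0) -expr2 -nrmE -coord_adj.
apply: (le_trans (ler_norm _)); apply: (le_trans (Re_hdot_le _ _)).
by rewrite {1}/nrm Ti.
Qed.

Lemma nrm_coord_cvg x : (fun n => nrm (x n)) @ \oo --> supnorm x.
Proof.
apply: nondecreasing_cvgn.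
  by apply/nondecreasing_seqP => n; exact: nrm_coord_le.
by exists (supnorm x) => _ [n _ <-]; exact: nrm_le_supnorm.
Qed.

(* By polarisation this reduces to the convergence of norms, which increase. *)
Lemma hdot_coord_cvg x y : cvg ((fun n => hdot (x n) (y n)) @ \oo).
Proof.
have polar (a b : H) :
    Re (hdot a b) = 4^-1 * (nrm (a + b) ^+ 2 - nrm (a - b) ^+ 2).
  rewrite -!nrmE hdotBl !hdotBr hdotDl !hdotDr !(ReD, ReN) (Re_hdotC b a).
  by move: (Re (hdot a b)) (Re (hdot a a)) (Re (hdot b b)) => p q r; lra.
have Re_cvg (a b : K) : cvg ((fun n => Re (hdot (a n) (b n))) @ \oo).
  rewrite (_ : (fun n => _) = (fun n => 4^-1 *
     (nrm ((a + b) n) ^+ 2 - nrm ((a - b) n) ^+ 2))); last first.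
    by apply/funext => n; exact: polar.
  apply/cvg_ex; exists (4^-1 * (supnorm (a + b) ^+ 2 - supnorm (a - b) ^+ 2)).
  have sqr_cvg (c : K) : (fun n => nrm (c n) ^+ 2) @ \oo --> supnorm c ^+ 2.
    by apply: cvgM; exact: nrm_coord_cvg.
  by apply: cvgMl_tmp; apply: cvgB; exact: sqr_cvg.
(* The imaginary part of an inner product is the real part of the inner product with [i y], by
   conjugate-linearity. *)
have -> : (fun n => hdot (x n) (y n)) = (fun n => (Re (hdot (x n) (y n)))%:C
    + (0 +i* 1) * (Re (hdot (x n) (((0 +i* 1) *: y) n)))%:C).
  apply/funext => n; rewrite coord_seqZ hdotZr conj_i.
  case: (hdot _ _) => a b; apply/eqP; rewrite eq_complex /=; apply/andP.
  by split; apply/eqP; ring.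
have /cvg_ex[a xa] := Re_cvg x y.
have /cvg_ex[b xb] := Re_cvg x ((0 +i* 1) *: y).
apply/cvg_ex; exists (a%:C + (0 +i* 1) * b%:C).
apply: cvgD; first exact: real_complex_cvg xa.
by apply: cvgMl_tmp; exact: real_complex_cvg xb.
Qed.

Definition limdot x y : R[i] := lim ((fun n => hdot (x n) (y n)) @ \oo).

Lemma limdot_cvg x y :
  (fun n => hdot (x n) (y n)) @ \oo --> (limdot x y : (R[i] : numFieldType)).
Proof. exact: hdot_coord_cvg. Qed.

Lemma limdot_eq x y (l : R[i]) :
  (fun n => hdot (x n) (y n)) @ \oo --> (l : (R[i] : numFieldType)) ->
  limdot x y = l.
Proof. by move=> h; apply: complex_cvg_unique h; exact: limdot_cvg. Qed.

Lemma limdot_bilinear :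
  bilinear_for ( *%R : GRing.Scale.law _ _)
    (@Num.conj R[i] \; *%R : GRing.Scale.law _ _) limdot.
Proof.
split=> [y c a b|x c a b]; apply: limdot_eq.
  rewrite (_ : (fun n => _) =
               (fun n => c * hdot (a n) (y n) + hdot (b n) (y n))).
    by apply: cvgD; [apply: cvgMl_tmp|]; exact: limdot_cvg.
  by apply/funext => n; rewrite coord_seqD coord_seqZ hdotDl hdotZl.
rewrite (_ : (fun n => _) =
             (fun n => Num.conj c * hdot (x n) (a n) + hdot (x n) (b n))).
  by apply: cvgD; [apply: cvgMl_tmp|]; exact: limdot_cvg.
by apply/funext => n; rewrite coord_seqD coord_seqZ hdotDr hdotZr.
Qed.

Lemma limdot_norm x : limdot x x = `|x| ^+ 2.
Proof.
apply: limdot_eq; rewrite norm_supnorm.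
rewrite (_ : (fun n => _) = (fun n => (nrm (x n))%:C * (nrm (x n))%:C)).
  by apply: cvgM; apply: real_complex_cvg; exact: nrm_coord_cvg.
by apply/funext => n; rewrite hdotxx rmorphXn.
Qed.

HB.instance Definition _ := bilinear_isBilinear.Build R[i] K K R[i]
  ( *%R : GRing.Scale.law _ _) (@Num.conj R[i] \; *%R : GRing.Scale.law _ _)
  limdot limdot_bilinear.

Lemma limdot_hermitian x y : limdot x y = (-1) ^+ false * Num.conj (limdot y x).
Proof.
rewrite expr0 mul1r; apply: limdot_eq; apply/cvgrPdist_lt => e e0.
have /cvgrPdist_lt/(_ _ e0) := limdot_cvg (x := y) (y := x).
by apply: filterS => n; rewrite [hdot (x n) _]hdotC -rmorphB norm_conjC.
Qed.

Lemma limdot_gt0 x : x != 0 -> 0 < limdot x x.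
Proof. by move=> x0; rewrite limdot_norm exprn_gt0// normr_gt0. Qed.

HB.instance Definition _ := isHermitianSesquilinear.Build R[i] K false
  (@Num.conj R[i]) limdot limdot_hermitian.

HB.instance Definition _ := isDotProduct.Build R[i] K limdot limdot_gt0.

HB.instance Definition _ :=
  CompleteNormedModule_isHilbert.Build R K limdot_norm.

Lemma hdot_limdot x y :
  (fun n => hdot (x n) (y n)) @ \oo --> (hdot x y : (R[i] : numFieldType)).
Proof. exact: limdot_cvg. Qed.

End UnitarySpace.

(** * The unitary dilation of a representation *)

Section TCK.
Variables (R : realType) (H : hilbertType R).

Lemma projection_contraction (P : H -> H) : is_projection P ->
  forall x, nrm (P x) <= nrm x.
Proof.
move=> [PP Psa] x.
have [->|Px] := eqVneq (P x) 0; first by rewrite /nrm normr0 nrm_ge0.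
have Px0 : 0 < nrm (P x) by rewrite -ltcR -norm_nrm normr_gt0.
rewrite -(ler_pM2l Px0) -expr2 -nrmE Psa PP Re_hdotC.
exact: le_trans (ler_norm _) (Re_hdot_le _ _).
Qed.

Variables (E : digraph) (S : cell E -> {linear H -> H}).
Hypothesis hS : TCK_family S.
Implicit Types (e f : edge E) (v : vertex E) (x y : H).

Lemma tck_adjointE e x y :
  hdot (S (inr e) x) y = hdot x (adjoint (S (inr e)) y).
Proof. by apply: continuous_adjointE; exact: tck_bounded. Qed.

Lemma tck_edge_hdot e x y :
  hdot (S (inr e) x) (S (inr e) y) = hdot x (S (inl (sr e)) y).
Proof. by rewrite tck_adjointE tck_source. Qed.

Lemma tck_contraction c x : nrm (S c x) <= nrm x.
Proof.
case: c => [v|e]; first exact/projection_contraction/tck_proj.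
rewrite -(@ler_pXn2r _ 2) ?nnegrE ?nrm_ge0// -nrmE tck_edge_hdot.
apply: (le_trans (ler_norm _)); apply: (le_trans (Re_hdot_le _ _)).
by rewrite expr2 ler_wpM2l ?nrm_ge0//; exact/projection_contraction/tck_proj.
Qed.

(* The range inequality at a vector [x] of the range of [S_f]; since
   [<S_v x, x> <= |x|^2], it leaves no room for the components of [x] in the
   other ranges. *)
Lemma tck_range_norm f y :
  let x := S (inr f) y in
  \sum_(e | (rg e == rg f) && (e != f)) nrm (adjoint (S (inr e)) x) ^+ 2
    + nrm x ^+ 2 <= Re (hdot (S (inl (rg f)) x) x).
Proof.
rewrite /=; set x := S (inr f) y.
have := tck_range hS (rg f) x; rewrite lecE => /andP[_ h].
apply: (le_trans _ h); rewrite /range_sum hdot_suml.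
rewrite (big_morph (@complex.Re R) (@ReD R) (erefl (Re (0 : R[i])))).
rewrite [leRHS](bigD1 f)// [leLHS]addrC; apply: lerD.
  rewrite tck_adjointE nrmE /x tck_source// -!nrmE tck_edge_hdot.
  by rewrite (tck_proj hS _).2 (tck_proj hS _).1.
rewrite le_eqVlt; apply/orP; left; apply/eqP.
by apply: eq_bigr => e _; rewrite tck_adjointE nrmE.
Qed.

(** For the projection [P], [|x - P x|^2 = |x|^2 - <P x, x>], and [tck_range_norm] makes this
    nonpositive. *)
Lemma tck_range_fix f y : S (inl (rg f)) (S (inr f) y) = S (inr f) y.
Proof.
have /= := tck_range_norm f y; set x := S (inr f) y; set P := S (inl (rg f)).
have [PP Psa] : is_projection P := tck_proj hS (rg f).
move=> h; apply/eqP; rewrite eq_sym -subr_eq0 -normr_eq0 norm_nrm.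
have : nrm (x - P x) ^+ 2 <= 0.
  rewrite -nrmE hdotBl !hdotBr (Psa x (P x)) PP Psa subrr subr0 ReD ReN.
  rewrite subr_le0 nrmE -Psa; apply: le_trans h; rewrite lerDr.
  by apply: sumr_ge0 => e _; exact: sqr_ge0.
by rewrite exprn_even_le0//= => /eqP ->.
Qed.

(** Edges with different ranges are separated by the orthogonal vertex projections. For a common
    range, [tck_range_fix] reduces [tck_range_norm] to a sum of squares that is at most [0]. *)
Lemma tck_range_orth e f x y : e <> f -> hdot (S (inr e) x) (S (inr f) y) = 0.
Proof.
move=> ef; have [ref|/eqP ref] := eqVneq (rg e) (rg f); last first.
  rewrite -tck_range_fix (tck_proj hS (rg e)).2 -[S (inr f) y]tck_range_fix.
  by rewrite tck_orth// hdot0r.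
rewrite tck_adjointE.
suff -> : adjoint (S (inr e)) (S (inr f) y) = 0 by rewrite hdot0r.
have /= := tck_range_norm f y; rewrite tck_range_fix nrmE -lerBrDr subrr.
rewrite (bigD1 e)/=; last by rewrite ref eqxx; apply/eqP.
move=> h; apply/eqP; rewrite -normr_eq0 norm_nrm.
suff : nrm (adjoint (S (inr e)) (S (inr f) y)) ^+ 2 <= 0.
  by rewrite exprn_even_le0//= => /eqP ->.
by apply: le_trans h; rewrite lerDl; apply: sumr_ge0 => i _; exact: sqr_ge0.
Qed.

End TCK.

Section Restriction.
Variables (E : digraph) (G : self_similar E).
Hypothesis hG : forall e : edge E, exists m : nat, ss_res G m (inr e) <> 0%N.

(** By [(q + p)|_e = q|_{p.e} + p|_e], the assumption at the edge [p.e] gives a [q] that increases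
    the restriction by at least one. *)
Lemma res_unbounded (e : edge E) B : exists p, (B <= ss_res G p (inr e))%N.
Proof.
elim: B => [|B [p Bp]]; first by exists 0%N.
have [q /eqP q0] := hG (acte G p e).
by exists (q + p)%N; rewrite ss_resD -add1n leq_add ?lt0n.
Qed.

Lemma res_cvg (e : edge E) : (fun m => ss_res G m (inr e)) @ \oo --> \oo.
Proof.
move=> A [B _ BA]; have [p Bp] := res_unbounded e B.
exists p => // m /= pm; apply: BA => /=.
rewrite -(subnK pm) ss_resD; apply: (leq_trans Bp); exact: leq_addl.
Qed.

End Restriction.

(** * The unitary shift and the embedding of the original space *)

Section Shift.
Variables (R : realType) (H : hilbertType R) (T : {linear H -> H}).
Variable Ti : is_isometry T.
Local Notation K := (unitary_space Ti).
Implicit Types x y : K.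

Lemma shift_op_coherent p x : (fun n => x (n + p)%N) \in coherent_pred T.
Proof.
apply/coherentP; split=> [n h|]; first by rewrite addSn coord_adj.
by exists (supnorm x) => n; exact: nrm_le_supnorm.
Qed.

Definition shift_op p x : K := UnitarySpace Ti (shift_op_coherent p x).

Lemma shift_op_linear p : linear (shift_op p).
Proof. by move=> c x y; apply: coord_inj. Qed.

HB.instance Definition _ p :=
  GRing.isLinear.Build R[i] K K *:%R (shift_op p) (shift_op_linear p).

Lemma shift_op_isometry p : is_isometry (shift_op p).
Proof.
move=> x; rewrite !norm_supnorm; congr _%:C.
have h : (fun n => nrm (x (n + p)%N)) @ \oo --> supnorm x.
  by rewrite (cvg_shiftn p (fun n => nrm (x n))); exact: nrm_coord_cvg.
by rewrite -(cvg_lim _ h)// -(cvg_lim _ (nrm_coord_cvg (x := shift_op p x))).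
Qed.

Lemma shift_op_add p q x : shift_op (p + q) x = shift_op p (shift_op q x).
Proof. by apply: coord_inj => n /=; rewrite addnA. Qed.

Lemma shift_op1_surj x : exists y, shift_op 1 y = x.
Proof.
(* Coherence forces the new first coordinate to be [T^* x_0]. *)
have yc : (fun n => if n is m.+1 then x m else adjoint T (x 0%N))
    \in coherent_pred T.
  apply/coherentP; split=> [[|n] h|].
  - by rewrite isometry_adjointE.
  - by rewrite coord_adj.
  exists (Order.max (supnorm x) (nrm (adjoint T (x 0%N)))) => -[|n].
    by rewrite le_max lexx orbT.
  by rewrite le_max nrm_le_supnorm.
by exists (UnitarySpace Ti yc); apply: coord_inj => n; rewrite /= addn1.
Qed.

Lemma shift_op_surj p x : exists y, shift_op p y = x.
Proof.
elim: p x => [|p IHp] x.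
  by exists x; apply: coord_inj => n /=; rewrite addn0.
have [y <-] := IHp x; have [z <-] := shift_op1_surj y.
by exists z; rewrite -addn1 shift_op_add.
Qed.

Lemma orbit_op_coherent h : (fun n => iter n T h) \in coherent_pred T.
Proof.
apply/coherentP; split=> [n g|]; first by rewrite /= isometry_hdot.
by exists (nrm h); elim=> //= n IHn; rewrite {1}/nrm Ti.
Qed.

(** This is the inclusion of [H] in [K]: for [h] in [H] the coordinates [P_H U^n h] are [T^n h]. *)
Definition orbit_op h : K := UnitarySpace Ti (orbit_op_coherent h).

Lemma orbit_op_linear : linear orbit_op.
Proof.
move=> c h g; apply: coord_inj => n; rewrite coord_seqD coord_seqZ /=.
by elim: n => //= n ->; rewrite linearP.
Qed.

HB.instance Definition _ :=
  GRing.isLinear.Build R[i] H K *:%R orbit_op orbit_op_linear.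

Lemma orbit_op_isometry : is_isometry orbit_op.
Proof.
move=> h; rewrite norm_supnorm norm_nrm; congr _%:C; apply/eqP.
rewrite eq_le -[X in _ && (X <= _)]/(nrm (orbit_op h 0)) nrm_le_supnorm andbT.
by apply: supnorm_le; elim=> //= n IHn; rewrite {1}/nrm Ti.
Qed.

End Shift.

(** * The operators of the dilation and their relations *)

Section UnitaryDilation.
Variables (R : realType) (E : digraph) (G : self_similar E).
Hypothesis hG : forall e : edge E, exists m : nat, ss_res G m (inr e) <> 0%N.
Variables (H : hilbertType R) (V : nat -> {linear H -> H}).
Variables (S : cell E -> {linear H -> H}) (hVS : representation G V S).

Let V1_isometry : is_isometry (V 1%N) := rep_isometry hVS 1.
Local Notation K := (unitary_space V1_isometry).
Implicit Types (x y : K) (c : cell E) (v : vertex E) (e f : edge E).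
Let hS := rep_tck hVS.

Lemma rep_iter n h : V n h = iter n (V 1%N) h.
Proof.
elim: n h => [|n IHn] h; first exact: (rep_0 hVS).
by rewrite -[n.+1]add1n (rep_add hVS) IHn.
Qed.

Lemma coord_adjn x n p h : hdot (V p h) (x (p + n)%N) = hdot h (x n).
Proof.
by rewrite rep_iter; elim: p => //= p IHp; rewrite addSn coord_adj.
Qed.

Lemma coord_adjoint x n p : adjoint (V p) (x (p + n)%N) = x n.
Proof. by apply: adjoint_eq => h; rewrite coord_adjn. Qed.

Lemma cell_op_coherent c x :
  (fun m => S (actc G m c) (x (ss_res G m c))) \in coherent_pred (V 1%N).
Proof.
apply/coherentP; split=> [n h|]; last first.
  exists (supnorm x) => n; apply: le_trans (nrm_le_supnorm x _).
  exact: (tck_contraction hS).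
rewrite isometry_adjointE//.
(* With [c' = n.c], the relation used is [V_1^* S_{1.c'} = S_{c'} V_{1|c'}^*]; the last adjoint
   takes coordinate [1|c' + n|c] back to coordinate [n|c]. *)
have -> : actc G n.+1 c = actc G 1 (actc G n c) by rewrite /actc -ss_actD add1n.
have -> : ss_res G n.+1 c = (ss_res G 1 (actc G n c) + ss_res G n c)%N.
  by rewrite -ss_resD add1n.
by rewrite (rep_comm_adj hVS) coord_adjoint.
Qed.

Definition cell_op c x : K := UnitarySpace V1_isometry (cell_op_coherent c x).

Lemma cell_op_linear c : linear (cell_op c).
Proof. by move=> a x y; apply: coord_inj => n /=; rewrite linearP. Qed.

HB.instance Definition _ c :=
  GRing.isLinear.Build R[i] K K *:%R (cell_op c) (cell_op_linear c).

Lemma cell_op_contraction c x : nrm (cell_op c x) <= nrm x.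
Proof.
apply: supnorm_le => n; apply: le_trans (nrm_le_supnorm x _).
exact: (tck_contraction hS).
Qed.

Lemma hdot_coord_eq x y x' y' :
  (forall n, hdot (x n) (y n) = hdot (x' n) (y' n)) -> hdot x y = hdot x' y'.
Proof.
move=> xy; apply: limdot_eq; rewrite (funext xy); exact: hdot_limdot.
Qed.

Lemma cell_op_proj v : is_projection (cell_op (inl v)).
Proof.
split=> [x|x y].
  by apply: coord_inj => n /=; rewrite !ss_res_vertex (tck_proj hS _).1.
by apply: hdot_coord_eq => n /=; rewrite !ss_res_vertex (tck_proj hS _).2.
Qed.

Lemma cell_op_orth v w x : v <> w -> cell_op (inl v) (cell_op (inl w) x) = 0.
Proof.
move=> vw; apply: coord_inj => n /=; rewrite !ss_res_vertex tck_orth//.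
by move/perm_inj.
Qed.

Lemma cell_op_nondeg x : \sum_v cell_op (inl v) x = x.
Proof.
apply: coord_inj => n.
rewrite (big_morph (fun y : K => y n) (fun _ _ => coord_seqD _ _ _)
  (coord_seq0 V1_isometry n))/=.
under eq_bigr do rewrite ss_res_vertex.
rewrite -[RHS](tck_nondeg hS).
by rewrite [RHS](reindex_inj (@perm_inj _ (aut_vertex (ss_act G n)))).
Qed.

(** At index [n] the left side has the inner product that the right side has at index [n|_e],
    because [n|_e.s(e) = n.s(e)]. The limits agree since [n|_e] tends to infinity. *)
Lemma cell_op_edge_hdot e x y :
  hdot (cell_op (inr e) x) (cell_op (inr e) y)
  = hdot x (cell_op (inl (sr e)) y).
Proof.
apply: limdot_eq.
pose u n := hdot (x n) (cell_op (inl (sr e)) y n).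
rewrite (_ : (fun n => _) = u \o (fun n => ss_res G n (inr e))); last first.
  apply/funext => n /=; rewrite /u/= (tck_edge_hdot hS) ss_res_vertex.
  by rewrite aut_sr /actc /= -ss_act_res.
apply: cvg_comp; first exact: res_cvg hG _.
exact: hdot_limdot.
Qed.

Lemma cell_op_edge_adj e x :
  adjoint (cell_op (inr e)) (cell_op (inr e) x) = cell_op (inl (sr e)) x.
Proof. by apply: adjoint_eq => y; exact: cell_op_edge_hdot. Qed.

Lemma cell_op_range_fix e x :
  cell_op (inl (rg e)) (cell_op (inr e) x) = cell_op (inr e) x.
Proof.
apply: coord_inj => n /=; rewrite ss_res_vertex -aut_rg.
exact: (tck_range_fix hS).
Qed.

Lemma cell_op_range_orth e f x y : e <> f ->
  hdot (cell_op (inr e) x) (cell_op (inr f) y) = 0.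
Proof.
move=> ef; rewrite -(hdot0l (0 : K)); apply: hdot_coord_eq => n /=.
by rewrite (tck_range_orth hS) ?hdot0l//; move/perm_inj.
Qed.

Lemma cell_op_continuous c : continuous (cell_op c).
Proof.
exact: (contraction_continuous (T := cell_op c) (@cell_op_contraction c)).
Qed.

(* Bessel's inequality for the orthogonal ranges of the [cell_op (inr e)]. *)
Lemma cell_op_range v : op_le (range_sum cell_op v) (cell_op (inl v)).
Proof.
move=> x; set w := range_sum _ v x.
pose P : {linear K -> K} := cell_op (inl v).
rewrite -[cell_op (inl v)]/(P : K -> K).
pose z e := adjoint (cell_op (inr e)) x.
have adjE e y : hdot (cell_op (inr e) y) x = hdot y (z e).
  have Sc := @cell_op_continuous (inr e).
  exact: (continuous_adjointE (T := cell_op (inr e)) Sc).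
have [PP Psa] : is_projection P := cell_op_proj v.
have Pw : P w = w.
  rewrite /w /range_sum linear_sum; apply: eq_bigr => e /eqP ev.
  by rewrite /P -ev; exact: cell_op_range_fix.
have wx : hdot w x = \sum_(e | rg e == v) hdot (z e) (z e).
  by rewrite hdot_suml; apply: eq_bigr => e _; rewrite adjE.
have ww : hdot w w =
    \sum_(e | rg e == v) hdot (cell_op (inr e) (z e)) (cell_op (inr e) (z e)).
  rewrite {1}/w hdot_suml; apply: eq_bigr => e ev.
  rewrite hdot_sumr (bigD1 e)//=.
  rewrite big1 ?addr0// => f /andP[_ /eqP fe]; apply: cell_op_range_orth.
  by move=> ef; apply: fe.
have wwx : hdot w w <= hdot w x.
  rewrite ww wx; apply: ler_sum => e _; rewrite !hdotxx lecR.
  by rewrite ler_pXn2r ?nnegrE ?nrm_ge0// cell_op_contraction.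
have xw : hdot x w = hdot w x.
  rewrite hdotC wx rmorph_sum; apply: eq_bigr => e _.
  by rewrite hdotxx; exact: conj_realC.
(* This yields [<P x, x> >= 2 <w, x> - <w, w>], and [wwx] bounds the right side below by
   [<w, x>]. *)
have := hdot_ge0 (P x - w).
rewrite hdotBl !hdotBr -[hdot (P x) (P x)]Psa PP [hdot (P x) w]Psa Pw xw.
rewrite -[hdot w (P x)]Psa Pw => h.
rewrite -subr_ge0 (_ : _ - _ =
    (hdot (P x) x - hdot w x - (hdot w x - hdot w w)) +
    (hdot w x - hdot w w)).
  by rewrite addr_ge0// subr_ge0.
by rewrite subrK.
Qed.

Lemma cell_op_tck : TCK_family (cell_op : cell E -> {linear K -> K}).
Proof.
split.
- exact: cell_op_proj.
- exact: cell_op_orth.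
- by move=> e; exact: cell_op_continuous.
- exact: cell_op_edge_adj.
- exact: cell_op_range.
- exact: cell_op_nondeg.
Qed.

Lemma shift_op_cell_op p c x :
  shift_op p (cell_op c x) = cell_op (actc G p c) (shift_op (ss_res G p c) x).
Proof.
by apply: coord_inj => n /=; rewrite /actc ss_actD ss_resD.
Qed.

Lemma cell_op_representation :
  representation G (fun p => shift_op p : {linear K -> K})
    (cell_op : cell E -> {linear K -> K}).
Proof.
split.
- by move=> p; exact: shift_op_isometry.
- exact: shift_op_add.
- by move=> x; apply: coord_inj => n /=; rewrite addn0.
- exact: cell_op_tck.
- exact: shift_op_cell_op.
(* As the shifts are onto, [x] is the shift of some [y] by [p|_c]; the adjoint relation then follows
   from the first one by cancelling isometries. *)
- move=> p c x; have [y <-] := shift_op_surj (ss_res G p c) x.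
  rewrite (isometry_adjointK (T := shift_op (ss_res G p c))
    (@shift_op_isometry _ _ _ _ _)).
  rewrite [X in adjoint _ X](_ : _ = shift_op p (cell_op c y)); last first.
    by rewrite shift_op_cell_op.
  exact: (isometry_adjointK (T := shift_op p) (@shift_op_isometry _ _ _ _ p)).
Qed.

(** In coordinate [n], the second relation is [V_n S_c = S_{n.c} V_{n|c}]. Thus the dilation extends
    [(V, S)]: the copy of [H] is invariant. *)
Lemma orbit_op_intertwines :
  intertwines (orbit_op V1_isometry : {linear H -> K}) V S
    (fun p => shift_op p : {linear K -> K})
    (cell_op : cell E -> {linear K -> K}).
Proof.
split=> [p h|c h]; apply: coord_inj => n; rewrite /= -!rep_iter.
  by rewrite (rep_add hVS).
exact: (rep_comm hVS).
Qed.

End UnitaryDilation.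

(** * Extensions as dilations, and what a splitting would imply *)

Lemma intertwines_op_path (R : realType) (E : digraph) (H K : hilbertType R)
  (J : {linear H -> K}) (S : cell E -> {linear H -> H})
  (S' : cell E -> {linear K -> K}) (m : epath E) (h : H) :
  (forall c x, J (S c x) = S' c (J x)) ->
  J (op_path S m h) = op_path S' m (J h).
Proof.
move=> JS; rewrite /op_path; case: (path_edges m) => [|e es]; first exact: JS.
by elim: (e :: es) => //= f fs <-.
Qed.

Lemma intertwines_dilation (R : realType) (E : digraph) (G : self_similar E)
  (H K : hilbertType R) (J : {linear H -> K})
  (V : nat -> {linear H -> H}) (S : cell E -> {linear H -> H})
  (V' : nat -> {linear K -> K}) (S' : cell E -> {linear K -> K}) :
  is_isometry J -> representation G V' S' -> intertwines J V S V' S' ->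
  is_dilation G J V S V' S'.
Proof.
move=> Ji rV' [JV JS]; split=> // m p x.
by rewrite -JV -(intertwines_op_path _ _ JS) isometry_adjointK.
Qed.

(** In a splitting, [V'_p] is the direct sum of [V_p] and an operator on the complement, so its
    surjectivity passes to the summand [V_p]. *)
Lemma trivial_dilation_surj (R : realType) (E : digraph) (G : self_similar E)
  (H K : hilbertType R) (J : {linear H -> K})
  (V : nat -> {linear H -> H}) (S : cell E -> {linear H -> H})
  (V' : nat -> {linear K -> K}) (S' : cell E -> {linear K -> K}) p :
  is_isometry J -> trivial_dilation G J V S V' S' ->
  (forall y, exists x, V' p x = y) -> forall h, exists g, V p g = h.
Proof.
move=> Ji [L [J' [VL [SL [_ _ [JJ' KE] [JV _] [J'V _]]]]]] V's h.
have [y yh] := V's (J h); have [g [z yE]] := KE y.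
exists g; apply/eqP; rewrite eq_sym -subr_eq0; apply/eqP.
(* This vector lies in both of the orthogonal ranges of [J] and [J'], so it vanishes. *)
have {yh}hE : J (h - V p g) = J' (VL p z).
  by rewrite linearB JV J'V -yh yE linearD addrC addKr.
by apply: hdot_eq0; rewrite -(isometry_hdot Ji) {2}hE JJ'.
Qed.

(** * Wandering vectors *)

Section ClosedSpan.
Variables (R : realType) (H : hilbertType R).
Implicit Types (A : set H) (x y : H).

Lemma closed_span_orth A y : (forall a, A a -> hdot a y = 0) ->
  forall x, closed_span A x -> hdot x y = 0.
Proof.
move=> Ay x xA; apply/eqP; apply: contrapT => /negP xy.
have xy0 : 0 < `|hdot x y| by rewrite normr_gt0.
have hx : (fun u => hdot u y) @ nbhs x --> hdot x y.
  by apply: hdot_cvgl; exact: cvg_id.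
have /cvgrPdist_lt/(_ _ xy0) := hx.
(* A combination of elements of [A] close to [x] would have inner product with [y] within [|<x, y>|]
   of [<x, y>], strictly, yet it is orthogonal to [y]. *)
move=> /xA[_ /= [[n [c [a [Aa ->]]]]]].
rewrite hdot_suml big1 ?subr0 ?ltxx// => k _.
by rewrite hdotZl Ay ?mulr0.
Qed.

Lemma isometry_closed_span_orth A (T : {linear H -> H}) y : is_isometry T ->
  (forall a, A a -> hdot (T a) y = 0) ->
  forall x, closed_span A x -> hdot (T x) y = 0.
Proof.
move=> Ti TA x xA; rewrite isometry_adjointE//.
by apply: closed_span_orth xA => a Aa; rewrite -isometry_adjointE ?TA.
Qed.

Lemma sub_closed_span A a : A a -> closed_span A a.
Proof.
move=> Aa; apply: subset_closure; exists 1%N, (fun=> 1), (fun=> a).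
by split=> //; rewrite big_ord1 scale1r.
Qed.

Lemma orth_not_surj (T : H -> H) y : hdot y y = 1 ->
  (forall x, hdot (T x) y = 0) -> ~ forall z, exists x, T x = z.
Proof.
move=> yy Ty /(_ y)[x xy]; have := Ty x; rewrite xy yy => /eqP.
by rewrite oner_eq0.
Qed.

(** The first basis vector [b a 0] of a copy of the shift is orthogonal to the range; a copy exists
    because [H] is nonzero. *)
Lemma pure_isometry_not_surj (T : {linear H -> H}) : (exists x : H, x <> 0) ->
  pure_isometry T -> ~ forall z, exists x, T x = z.
Proof.
move=> [x0 x0N] [Ti [A [b [[b1 b0 bT] Tb]]]].
have [a _] : exists a : A, True.
  apply: contrapT => noA; apply: x0N; apply: hdot_eq0.
  apply: (@closed_span_orth (range (fun x : A * nat => b x.1 x.2))).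
    by move=> z [[a n] _ _]; case: noA; exists a.
  by rewrite bT.
apply: (@orth_not_surj _ (b a 0%N)); first exact: (b1 (a, 0%N)).
move=> x; apply: (isometry_closed_span_orth
  (A := range (fun x : A * nat => b x.1 x.2))) => //.
  by move=> _ [[a' n] _ <-] /=; rewrite Tb; apply: (b0 (a', n.+1) (a, 0%N)).
by rewrite bT.
Qed.

End ClosedSpan.

Section LeftRegular.
Variables (R : realType) (E : digraph) (G : self_similar E).

(** The action is only a semigroup homomorphism, but [0] acts by an idempotent permutation. *)
Lemma act0 (v : vertex E) : actv G 0 v = v.
Proof.
apply: (@perm_inj _ (aut_vertex (ss_act G 0))).
by have := ss_actD G 0 0 (inl v) => /= -[].
Qed.

(** [V_1] sends [d_{mu,p}] to [d_{1.mu, 1|mu + p}]. This is never [d_{v,0}]: either [mu] has an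
    edge, and so does [1.mu], or [mu] is a vertex and [1|mu = 1]. *)
Lemma left_regular_model_orth (M : hilbertType R) (d : epath E -> nat -> M)
    (V : nat -> {linear M -> M}) (S : cell E -> {linear M -> M}) v x :
  left_regular_model G d V S ->
  hdot (V 1%N x) (d (@EPath _ v [::] isT) 0%N) = 0.
Proof.
move=> dVS; have [_ d0 dT] := lrm_basis dVS.
apply: (isometry_closed_span_orth
  (A := range (fun x : epath E * nat => d x.1 x.2))).
- exact: lrm_isometry dVS 1.
- move=> _ [[m p] _ <-] /=; rewrite (lrm_V dVS).
  apply: (d0 (_, _) (_, _)) => -[].
  by case: m => r [|e es] //= ?; rewrite /res_path.
- by rewrite dT.
Qed.

Lemma lambda_wandering v (H : hilbertType R)
    (V : nat -> {linear H -> H}) (S : cell E -> {linear H -> H}) :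
  is_lambda G v V S ->
  exists y, hdot y y = 1 /\ forall x, hdot (V 1%N x) y = 0.
Proof.
move=> [M [d [LV [LS [U [dVS Ui rU [UV _]]]]]]].
pose dv := d (@EPath _ v [::] isT) 0%N.
have [y _ yd] : range U dv.
  (* The vector [d_{v,0}] belongs to the subspace of [lambda_v] because [s(v) = v = 0.v]. *)
  rewrite rU; apply: sub_closed_span; exists (@EPath _ v [::] isT), 0%N.
  by rewrite act0.
exists y; split=> [|x]; rewrite -(isometry_hdot Ui) yd.
  by have [d1 _ _] := lrm_basis dVS; exact: (d1 (_, _)).
by rewrite UV; exact: left_regular_model_orth dVS.
Qed.

Lemma left_regular_not_surj (H : hilbertType R)
    (V : nat -> {linear H -> H}) (S : cell E -> {linear H -> H}) :
  (exists x : H, x <> 0) -> is_isometry (V 1%N) -> left_regular G V S ->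
  ~ forall z, exists x, V 1%N x = z.
Proof.
move=> [x0 x0N] Vi [A [L [LV [LS [W [hL [Wi Worth WT] hW]]]]]].
have [i _] : exists i : {v & A v}, True.
  apply: contrapT => noi; apply: x0N; apply: hdot_eq0.
  apply: (@closed_span_orth _ _ [set x | exists i y, x = W i y]).
    by move=> z [i _]; case: noi; exists i.
  by rewrite WT.
have [y [y1 yV]] := lambda_wandering (hL i).
apply: (@orth_not_surj _ _ _ (W i y)); first by rewrite isometry_hdot.
move=> x; apply: (isometry_closed_span_orth
  (A := [set x | exists i y, x = W i y])) => //.
  move=> _ [j [z ->]]; rewrite -(hW j).1.
  (* Within the summand [i] the vector [y] is wandering; the other summands are invariant and
     orthogonal to it. *)
  have [ji|ji] := pselect (j = i).
    by subst j; rewrite isometry_hdot.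
  exact: Worth.
by rewrite WT.
Qed.

End LeftRegular.

Theorem corollary5p6 (R : realType) (E : digraph) (hE : source_free E)
    (G : self_similar E)
    (hG : forall e : edge E, exists m : nat, ss_res G m (inr e) <> 0%N)
    (H : hilbertType R) (hH : exists x : H, x <> 0)
    (V : nat -> {linear H -> H}) (S : cell E -> {linear H -> H})
    (hVS : representation G V S)
    (htype : pure_CK_type V S \/ left_regular G V S) :
  exists (K : hilbertType R) (J : {linear H -> K})
      (V' : nat -> {linear K -> K}) (S' : cell E -> {linear K -> K}),
    is_dilation G J V S V' S' /\ ~ trivial_dilation G J V S V' S'.
Proof.
pose Vi : is_isometry (V 1%N) := rep_isometry hVS 1.
pose Ji := @orbit_op_isometry _ _ _ Vi.
exists (unitary_space Vi), (orbit_op Vi), (fun p => shift_op p).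
exists (fun c => @cell_op _ _ _ _ _ _ hVS c); split.
  apply: intertwines_dilation Ji _ (orbit_op_intertwines hVS).
  exact: (cell_op_representation hG hVS).
(* A splitting would make [V_1] surjective, since the shift [V'_1] is; both types of representation
   exclude this. *)
move=> /(@trivial_dilation_surj _ _ _ _ _ _ _ _ _ _ 1%N) Vsurj.
have {}Vsurj := Vsurj Ji (@shift_op_surj _ _ _ Vi 1).
case: htype => [[Vpure _]|VSreg].
  exact: pure_isometry_not_surj hH Vpure Vsurj.
exact: left_regular_not_surj hH Vi VSreg Vsurj.
Qed.
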